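(* Let $f$ be continuous on $[0,1]$, let $u\in C^2([0,1])$ be the solution of $-u''(x)=f(x)$ for $x\in(0,1)$, $u(0)=u(1)=0$, and let $u_h=\sum_{i=1}^{n-1}u_i\varphi_i\in V_h$ be the finite element solution, that is, the function in $V_h$ satisfying $a(u_h,v_h)=(f,v_h)$ for all $v_h\in V_h$. Then $u_h$ coincides with the (continuous, piecewise) linear interpolant of $u$ on the nodes $x_0,x_1,\dots,x_n$; in other words, $u_j=u(x_j)$ for $j=1,2,\dots,n-1$.
   Context: Let $n\ge 2$ and let $0=x_0<x_1<\cdots<x_n=1$ be arbitrary (possibly non-uniformly spaced) nodes. $V=H^1_0(0,1)$, $a(u,v)=\int_0^1u'(x)v'(x)\,dx$, and $(f,v)=\int_0^1 f(x)v(x)\,dx$. $V_h\subset V$ is the space of all continuous functions on $[0,1]$ that are linear on each $[x_j,x_{j+1}]$, $j=0,\dots,n-1$, and vanish at $0$ and $1$. $\{\varphi_j\}_{j=1}^{n-1}\subset V_h$ is its nodal basis, determined by $\varphi_i(x_j)=\delta_{ij}$. *)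

(* Defs.v *)
From HB Require Import structures.
From mathcomp Require Import all_boot all_order all_algebra.
From mathcomp Require Import all_classical all_reals all_analysis.
Set Implicit Arguments.
Unset Strict Implicit.
Unset Printing Implicit Defensive.
Import Order.TTheory GRing.Theory Num.Theory.
Import numFieldNormedType.Exports.
Local Open Scope classical_set_scope.
Local Open Scope ring_scope.

(* Functions on [0,1] are total functions R -> R of which only the values on
   [0,1] matter; a mesh is the first n+1 terms of a sequence of reals. *)

Definition mesh (R : realType) (n : nat) (x : nat -> R) : Prop :=
  [/\ x 0%N = 0, x n = 1 & forall j, (j < n)%N -> x j < x j.+1].

Definition linear_on (R : realType) (a b : R) (v : R -> R) : Prop :=
  exists m c : R, forall t : R, t \in `[a, b] -> v t = m * t + c.

Definition continuous_pw_linear (R : realType) (n : nat) (x : nat -> R)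
    (v : R -> R) : Prop :=
  {within `[0, 1], continuous v} /\
  forall j, (j < n)%N -> linear_on (x j) (x j.+1) v.

Definition Vh (R : realType) (n : nat) (x : nat -> R) : set (R -> R) :=
  [set v | [/\ continuous_pw_linear n x v, v 0 = 0 & v 1 = 0]].

Definition nodal_basis (R : realType) (n : nat) (x : nat -> R)
    (phi : nat -> R -> R) : Prop :=
  forall i, (0 < i < n)%N ->
    Vh n x (phi i) /\
    forall j, (0 < j < n)%N -> phi i (x j) = (i == j)%:R.

(* A function in H^1(0,1) has an absolutely continuous representative, which
   is differentiable almost everywhere with derivative its weak derivative.
   Hence the pointwise derivative can be used; the (junk) values it takes where
   the function is not differentiable, e.g. at the nodes, form a null set. *)
Definition bilin (R : realType) (u v : R -> R) : R :=
  \int[lebesgue_measure]_(t in `[0, 1]) (derive1 u t * derive1 v t).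

Definition pairing (R : realType) (f v : R -> R) : R :=
  \int[lebesgue_measure]_(t in `[0, 1]) (f t * v t).

(* u is continuous on [0,1], twice differentiable in (0,1), and its first two
   derivatives extend continuously from (0,1) to [0,1] (by u1 and u2); the
   derivatives of u at 0 and 1 themselves would depend on u outside [0,1]. *)
Definition C2_01 (R : realType) (u : R -> R) : Prop :=
  {within `[0, 1], continuous u} /\
  exists u1 u2 : R -> R,
    [/\ {within `[0, 1], continuous u1},
        {within `[0, 1], continuous u2},
        forall t : R, t \in `]0, 1[ -> derivable u t 1 /\ derive1 u t = u1 t &
        forall t : R, t \in `]0, 1[ ->
          derivable (derive1 u) t 1 /\ derive1n 2 u t = u2 t].

Definition poisson_solution (R : realType) (f u : R -> R) : Prop :=
  [/\ C2_01 u,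
      forall t : R, t \in `]0, 1[ -> - derive1n 2 u t = f t,
      u 0 = 0 &
      u 1 = 0].

Definition fem_solution (R : realType) (n : nat) (x : nat -> R)
    (f uh : R -> R) : Prop :=
  Vh n x uh /\ forall vh, Vh n x vh -> bilin uh vh = pairing f vh.

Definition linear_interpolant (R : realType) (n : nat) (x : nat -> R)
    (u w : R -> R) : Prop :=
  continuous_pw_linear n x w /\ forall j, (j <= n)%N -> w (x j) = u (x j).

(* Main.v *)
(* For v in Vh with slopes s_k, integrating over each mesh cell gives
   a(uh, v) = sum_k s_k (uh(x_{k+1}) - uh(x_k)) and, as f v has the
   antiderivative s_k u - u' v there, (f, v) = sum_k s_k (u(x_{k+1}) - u(x_k)).
   Testing with the v whose nodal values are those of e = uh - u yields
   sum_k (e_{k+1} - e_k)^2 / (x_{k+1} - x_k) = 0, so the nodal error is constant,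
   hence zero. *)
Require Import Defs.
From HB Require Import structures.
From mathcomp Require Import all_boot all_order all_algebra.
From mathcomp Require Import all_classical all_reals all_analysis.
From mathcomp Require Import measurable_realfun ring.
Set Implicit Arguments.
Unset Strict Implicit.
Unset Printing Implicit Defensive.
Import Order.TTheory GRing.Theory Num.Theory.
Import numFieldNormedType.Exports.
Local Open Scope classical_set_scope.
Local Open Scope ring_scope.

(** The integrand [g] may take junk values at the endpoints, as a pointwise derivative does at a
    node, so it is controlled only inside, by a continuous [G]. Measurability of [g] is returned as
    well because gluing adjacent cells requires it. *)
Lemma itv_oc_FTC2 (R : realType) (a b : R) (g G F : R -> R) :
  a < b ->
  {within `[a, b], continuous G} -> {within `[a, b], continuous F} ->
  {in `]a, b[, forall t : R^o, is_derive t 1 F (G t)} ->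
  {in `]a, b[, g =1 G} ->
  measurable_fun `]a, b] g /\
  (\int[lebesgue_measure]_(t in `]a, b]) (g t)%:E)%E = (F b - F a)%:E.
Proof.
move=> ab cG cF dF gG.
have mG : measurable_fun `]a, b[ G.
  apply: (@measurable_funS _ _ _ _ `[a, b]%classic) => //.
    exact: subset_itvW.
  exact: subspace_continuous_measurable_fun.
have mg : measurable_fun `]a, b[ g.
  by apply: eq_measurable_fun mG => t; rewrite inE => /gG.
split; first exact/measurable_fun_itv_bndo_bndcP.
have [_ Fa Fb] := (continuous_within_itvP _ ab).1 cF.
(* Drop the endpoint [b], exchange [g] for [G] on the open interval, then restore both endpoints to
   reach the closed interval of the fundamental theorem. *)
rewrite integral_itv_bndoo; last exact/measurable_EFinP.
under eq_integral => t /set_mem/gG -> do over.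
rewrite -(@integral_itv_bndoo _ a b _ true false); last exact/measurable_EFinP.
rewrite (@continuous_FTC2 _ _ F) ?EFinB//; first by split=> // t /dF [].
by move=> t /dF [_ <-]; rewrite derive1E.
Qed.

(* Half-open intervals make the pieces disjoint; only the open ones matter up
   to a null set. *)
Lemma piecewise_FTC2 (R : realType) (n : nat) (x : nat -> R) (g : R -> R)
    (G F : nat -> R -> R) :
  (forall k, (k < n)%N -> x k < x k.+1) ->
  (forall k, (k < n)%N -> {within `[x k, x k.+1], continuous (G k)}) ->
  (forall k, (k < n)%N -> {within `[x k, x k.+1], continuous (F k)}) ->
  (forall k, (k < n)%N ->
    {in `]x k, x k.+1[, forall t : R^o, is_derive t 1 (F k) (G k t)}) ->
  (forall k, (k < n)%N -> {in `]x k, x k.+1[, g =1 G k}) ->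
  \int[lebesgue_measure]_(t in `[x 0%N, x n]) g t =
  \sum_(k < n) (F k (x k.+1) - F k (x k)).
Proof.
move=> xS cG cF dF gG.
have H m : (m <= n)%N ->
  [/\ x 0%N <= x m, measurable_fun `]x 0%N, x m] g &
  (\int[lebesgue_measure]_(t in `]x 0%N, x m]) (g t)%:E)%E =
  (\sum_(k < m) (F k (x k.+1) - F k (x k)))%:E].
  elim: m => [_|m IH mn].
    rewrite set_itvoc0 integral_set0 big_ord0; split=> //.
    exact: measurable_fun_set0.
  have [x0m mg ig] := IH (ltnW mn).
  have [mg' ig'] :=
    itv_oc_FTC2 (xS m mn) (cG m mn) (cF m mn) (dF m mn) (gG m mn).
  have xm := ltW (xS m mn).
  have E : `]x 0%N, x m.+1]%classic =
      `]x 0%N, x m]%classic `|` `]x m, x m.+1]%classic.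
    by rewrite -itv_bndbnd_setU// bnd_simp.
  have mU : measurable_fun (`]x 0%N, x m]%classic `|` `]x m, x m.+1]%classic) g.
    exact/measurable_funU.
  split; [exact: le_trans xm | by rewrite E |].
  rewrite E integral_setU//=.
  - by rewrite ig ig' big_ord_recr/= EFinD.
  - exact/measurable_EFinP.
  - apply/disj_set2P; rewrite predeqE => t; split=> //= -[].
    by rewrite /= !in_itv/= => /andP[_ tm] /andP[/(le_lt_trans tm)]; rewrite ltxx.
have [_ mg ig] := H n (leqnn n).
rewrite /Rintegral -integral_itv_obnd_cbnd ?ig//.
exact/measurable_EFinP.
Qed.

Definition slope (R : realType) (a b : R) (v : R -> R) : R :=
  (v b - v a) / (b - a).

Lemma linear_onE (R : realType) (a b : R) (v : R -> R) :
  a < b -> linear_on a b v ->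
  {in `[a, b], forall t, v t = v a + slope a b v * (t - a)}.
Proof.
move=> ab [m [c vE]] t tab; rewrite /slope (vE t)// !vE ?bound_itvE ?ltW//.
have : b - a != 0 by rewrite subr_eq0 gt_eqF.
by move=> ?; field.
Qed.

Lemma is_derive_affine (R : realType) (t k m a : R^o) :
  is_derive t 1 (fun s : R^o => k + m * (s - a)) m.
Proof.
have -> : (fun s : R^o => k + m * (s - a)) = cst (k - m * a) + m \*: id.
  by apply/funext => s /=; rewrite mulrBr addrA addrAC.
have df := is_deriveD (is_derive_cst (k - m * a : R^o) t 1)
  (is_deriveZ m (is_derive_id t (1 : R^o))).
by apply: (is_derive_eq df); rewrite add0r [LHS]mulr1.
Qed.

Lemma linear_on_derive1 (R : realType) (a b : R) (v : R -> R) :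
  a < b -> linear_on a b v -> {in `]a, b[, derive1 v =1 cst (slope a b v)}.
Proof.
move=> ab vl t tab; rewrite derive1E /=.
(* An interior point has a neighbourhood inside the cell, where [v] agrees with this globally affine
   function. *)
rewrite (near_eq_derive (g := fun s : R^o => v a + slope a b v * (s - a))).
  by have [] := is_derive_affine t (v a) (slope a b v) a.
near=> s; apply: linear_onE => //; apply: subset_itv_oo_cc.
by near: s; exact: near_in_itvoo.
Unshelve. all: by end_near. Qed.

Lemma mesh_ge0_le1 (R : realType) (n : nat) (x : nat -> R) (k : nat) :
  mesh n x -> (k <= n)%N -> 0 <= x k <= 1.
Proof.
move=> [<- <- xS] kn.
have mono i j : (i <= j <= n)%N -> x i <= x j.
  elim: j => [|j IH]; first by rewrite leqn0 => /andP[/eqP ->].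
  rewrite leq_eqVlt => /andP[/predU1P[->//|ij] jn].
  by apply: le_trans (ltW (xS _ jn)); rewrite IH// -ltnS ij ltnW.
by rewrite !mono ?kn ?leqnn.
Qed.

Lemma subset_mesh_itv (R : realType) (n : nat) (x : nat -> R) (k : nat) :
  mesh n x -> (k < n)%N -> {subset `[x k, x k.+1] <= `[0 : R, 1]}.
Proof.
move=> hx kn; have /andP[x0 _] := mesh_ge0_le1 hx (ltnW kn).
have /andP[_ x1] := mesh_ge0_le1 hx kn.
by apply/subitvP; rewrite subitvE !bnd_simp x0.
Qed.

(** The integrand is constant on each open cell. The asymmetric form, slopes of [w] against nodal
    increments of [v], is chosen to match [pairing_poisson] term by term. *)
Lemma bilin_pw_linear (R : realType) (n : nat) (x : nat -> R) (v w : R -> R) :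
  mesh n x -> Vh n x v -> Vh n x w ->
  bilin v w = \sum_(k < n) slope (x k) (x k.+1) w * (v (x k.+1) - v (x k)).
Proof.
move=> [x0 xn xS] [[_ vl] _ _] [[_ wl] _ _]; rewrite /bilin -[X in `[X, _]]x0 -xn.
pose s k := slope (x k) (x k.+1) v * slope (x k) (x k.+1) w.
(* The zeros in the antiderivative give it the shape expected by [is_derive_affine]. *)
rewrite (@piecewise_FTC2 _ _ _ _ (fun k => cst (s k))
    (fun k t => 0 + s k * (t - 0))) //.
- apply: eq_bigr => k _; rewrite /s /slope.
  have : x k.+1 - x k != 0 by rewrite subr_eq0 gt_eqF// xS.
  by move=> ?; field.
- by move=> k kn; apply: continuous_subspaceT => t; exact: cvg_cst.
- move=> k kn; apply: derivable_within_continuous => t _.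
  by have [] := is_derive_affine t 0 (s k) 0.
- by move=> k kn t _; exact: is_derive_affine.
- move=> k kn t tk; rewrite (linear_on_derive1 _ (vl k kn))//; last exact: xS.
  by rewrite (linear_on_derive1 _ (wl k kn))//; exact: xS.
Qed.

(** The load sees [u] only through its nodal values; compared with [bilin_pw_linear], this says that
    the interpolant of [u] satisfies the Galerkin equations. *)
Lemma pairing_poisson (R : realType) (n : nat) (x : nat -> R) (f u v : R -> R) :
  mesh n x -> {within `[0, 1], continuous f} -> poisson_solution f u ->
  Vh n x v ->
  pairing f v = \sum_(k < n) slope (x k) (x k.+1) v * (u (x k.+1) - u (x k)).
Proof.
move=> hx cf [[cu [u1 [u2 [cu1 _ du du1]]]] uf _ _] [[cv vl] v0 v1].
have [x0 xn xS] := hx.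
pose s k := slope (x k) (x k.+1) v.
(* The affine extension of [v] beyond the cell is smooth everywhere, whereas [v] may have kinks at
   the nodes. *)
pose l k (t : R^o) : R^o := v (x k) + s k * (t - x k).
have cl k A : {within A, continuous (l k)}.
  apply: continuous_subspaceT => t; apply: differentiable_continuous.
  by apply/derivable1_diffP; have [] := is_derive_affine t (v (x k)) (s k) (x k).
have sub k : (k < n)%N -> [set` `[x k, x k.+1]] `<=` [set` `[0 : R, 1]].
  by move=> kn t; exact: (subset_mesh_itv hx kn).
have cw k (h : R -> R) : (k < n)%N -> {within `[0, 1], continuous h} ->
    {within `[x k, x k.+1], continuous h}.
  by move=> kn; apply: continuous_subspaceW; exact: sub.
have lE k : (k < n)%N -> {in `[x k, x k.+1], v =1 l k}.
  by move=> kn t tk; apply: linear_onE => //; [exact: xS|exact: vl].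
(* [s k * u - u' * v] is an antiderivative of [f v]: its boundary terms
   [u' v] telescope and vanish at both ends. *)
rewrite /pairing -[X in `[X, _]]x0 -xn.
rewrite (@piecewise_FTC2 _ _ _ _ (fun k t => f t * l k t)
    (fun k t => s k * u t - u1 t * l k t)).
- rewrite (eq_bigr (fun k : 'I_n => s k * (u (x k.+1) - u (x k)) -
      (u1 (x k.+1) * v (x k.+1) - u1 (x k) * v (x k)))); last first.
    move=> k _; have kk := ltW (xS k (ltn_ord k)).
    by rewrite /= -!(lE k) ?in_itv/= ?lexx ?kk//; ring.
  rewrite sumrB -(big_mkord xpredT
    (fun k => u1 (x k.+1) * v (x k.+1) - u1 (x k) * v (x k))).
  by rewrite telescope_sumr// x0 xn v0 v1 !mulr0 !subr0.
- exact: xS.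
- by move=> k kn t; apply: cvgM; [exact: cw|exact: cl].
- move=> k kn t; apply: cvgB.
    by apply: cvgM; [exact: cvg_cst|exact: cw].
  by apply: cvgM; [exact: cw|exact: cl].
- move=> k kn t tk.
  have t01 : t \in `]0, 1[.
    have /andP[x0k _] := mesh_ge0_le1 hx (ltnW kn).
    have /andP[_ x1k] := mesh_ge0_le1 hx kn.
    by apply: subset_itvW tk.
  have [du_t u1t] := du t t01; have [ddu ddu2] := du1 t t01.
  have Du : is_derive t 1 u (u1 t).
    by apply: DeriveDef; [exact: du_t|rewrite -u1t derive1E].
  (* The extension [u1] stands in for [derive1 u] to have continuity up to 0 and 1; the two agree
     near [t], so [u1] inherits the derivative [- f t]. *)
  have Du1 : is_derive t 1 u1 (- f t).
    apply: (@near_eq_is_derive _ _ _ (derive1 u)).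
      near=> r; apply: (du r _).2; near: r; exact: near_in_itvoo.
    by split => //; rewrite -(uf t t01) opprK /= derive1E.
  have Dl : is_derive t 1 (l k) (s k) by exact: is_derive_affine.
  (* Written with operations on functions, the derivative can be inferred from the product rule; the
     two terms [s k * u1 t] cancel and leave [f t * l k t]. *)
  have -> : (fun t => s k * u t - u1 t * l k t) = s k \*: u - u1 * l k by [].
  apply: is_derive_eq; rewrite /GRing.scale/=; ring.
- by move=> k kn t tk; rewrite (lE k kn)//; exact: subset_itv_oo_cc.
Unshelve. all: by end_near. Qed.

(** An arbitrary index list allows induction; membership is restricted to the list since
    [nodal_basis] constrains [phi i] only for interior indices. *)
Lemma Vh_sum (R : realType) (n : nat) (x : nat -> R) (phi : nat -> R -> R)
    (c : nat -> R) (s : seq nat) :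
  {in s, forall i, Vh n x (phi i)} ->
  Vh n x (fun t => \sum_(i <- s) c i * phi i t).
Proof.
elim: s => [_|i s IH H].
  split; rewrite ?big_nil//; split.
    apply: continuous_subspaceT => t.
    by under eq_fun do rewrite big_nil; exact: cvg_cst.
  by move=> j _; exists 0, 0 => t _; rewrite big_nil mul0r addr0.
have [[cs ls] s0 s1] := IH (fun j js => H j (mem_behead (s := i :: s) js)).
have [[cp lp] p0 p1] := H i (mem_head _ _).
under eq_fun do rewrite big_cons.
split; rewrite ?s0 ?s1 ?p0 ?p1 ?mulr0 ?addr0//; split.
  by move=> t; apply: cvgD; [apply: cvgM; [exact: cvg_cst|exact: cp]|exact: cs].
move=> j jn; have [m [k E]] := ls j jn; have [m' [k' E']] := lp j jn.
exists (c i * m' + m), (c i * k' + k) => t tj.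
by rewrite E// E'//; ring.
Qed.

Lemma nodal_sum_node (R : realType) (n : nat) (x : nat -> R)
    (phi : nat -> R -> R) (c : nat -> R) (j : nat) :
  nodal_basis n x phi -> (0 < j < n)%N ->
  \sum_(1 <= i < n) c i * phi i (x j) = c j.
Proof.
move=> hphi jn; rewrite (bigD1_seq j) ?mem_index_iota ?iota_uniq//=.
rewrite (hphi j jn).2// eqxx mulr1 big1_seq ?addr0// => i.
rewrite mem_index_iota => /andP[/negPf ij /hphi[_ /(_ j jn) ->]].
by rewrite ij mulr0.
Qed.

Theorem corollary2p3 (R : realType) (n : nat) (x : nat -> R)
    (phi : nat -> R -> R) (f u uh : R -> R) (c : nat -> R)
    (hn : (2 <= n)%N)
    (hx : mesh n x)
    (hphi : nodal_basis n x phi)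
    (hf : {within `[0, 1], continuous f})
    (hu : poisson_solution f u)
    (huh : fem_solution n x f uh)
    (hc : forall t : R, t \in `[0, 1] -> uh t = \sum_(1 <= i < n) c i * phi i t) :
  linear_interpolant n x u uh /\
  (forall j, (0 < j < n)%N -> c j = u (x j)).
Proof.
have [x0 xn xS] := hx; have [_ _ u0 u1] := hu.
have [Vuh galerkin] := huh; have [pw_uh uh0 uh1] := Vuh.
pose e j := uh (x j) - u (x j).
have e0 : e 0%N = 0 by rewrite /e x0 uh0 u0 subrr.
have en : e n = 0 by rewrite /e xn uh1 u1 subrr.
(* Since [e] vanishes at both end nodes, interior basis functions suffice to match it at all
   nodes. *)
pose v t := \sum_(1 <= i < n) e i * phi i t.
have Vv : Vh n x v.
  by apply: Vh_sum => i; rewrite mem_index_iota => /hphi[].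
have ve j : (j <= n)%N -> v (x j) = e j.
  have [_ v0 v1] := Vv.
  rewrite leq_eqVlt => /predU1P[->|jn]; first by rewrite en xn.
  case: j jn => [|j] jn; first by rewrite e0 x0.
  by rewrite /v (nodal_sum_node _ hphi).
have := galerkin _ Vv.
rewrite (bilin_pw_linear hx)// (pairing_poisson hx hf hu)// => /eqP.
rewrite -subr_eq0 -sumrB => /eqP energy0.
(* As [v] has nodal values [e], its slope times the increment of [e] is [E k], the energy of the
   nodal error on one cell. These are nonnegative with sum zero, so each vanishes. *)
pose E k := (e k.+1 - e k) ^+ 2 / (x k.+1 - x k).
have E0 (k : 'I_n) : E k = 0.
  apply: (@psumr_eq0P _ _ xpredT (fun k : 'I_n => E k)) => //.
    by move=> i _; rewrite divr_ge0 ?sqr_ge0// subr_ge0 ltW// xS.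
  rewrite -[RHS]energy0; apply: eq_bigr => i _.
  by rewrite /slope !ve// 1?ltnW// /E /e; ring.
(* Cell widths are nonzero, so [E j = 0] forces [e j.+1 = e j], and the zero value spreads from the
   left end. *)
have e_eq0 j : (j <= n)%N -> e j = 0.
  elim: j => // j IH jn; have /eqP := E0 (Ordinal jn).
  rewrite mulf_eq0 invr_eq0 (subr_eq0 (x _)) (gt_eqF (xS _ jn)) orbF.
  by rewrite sqrf_eq0 subr_eq0 /= IH 1?ltnW// => /eqP.
have uhE j : (j <= n)%N -> uh (x j) = u (x j).
  by move=> /e_eq0/eqP; rewrite subr_eq0 => /eqP.
split=> // j jn; have /andP[_ /ltnW jn'] := jn.
by rewrite -uhE// hc ?in_itv/= ?(mesh_ge0_le1 hx)// (nodal_sum_node _ hphi).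
Qed.
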